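(* Let $\Delta$ be an irreducible root system with set of simple roots $\Pi$, and let $\mathcal A_{\mathsf{pr}}$ be the set of primitive amazing roots. Then (i) $\#\mathcal A_{\mathsf{pr}}=\#\Pi$; (ii) for each $\gamma\in\mathcal A_{\mathsf{pr}}$ there is a unique $\alpha\in\Pi$ such that $\gamma-\alpha\in\Delta^+\cup\{0\}$, and the map $\mathcal A_{\mathsf{pr}}\to\Pi$ taking $\gamma$ to this $\alpha$ is a bijection.
   Context: Let $\Delta$ be an irreducible (reduced, crystallographic) root system, the root system of a simple complex Lie algebra, with positive roots $\Delta^+$, simple roots $\Pi$, and highest root $\theta$. $\Delta^+_l$ is the set of long positive roots (all roots are long in the simply-laced case). The partial order on $\Delta^+$: $\mu\preccurlyeq\nu$ if $\nu-\mu$ is a non-negative integral combination of simple roots. An upper ideal is a subset $I\subset\Delta^+$ such that $\nu\in I$, $\gamma\in\Delta^+$, $\nu\preccurlyeq\gamma$ imply $\gamma\in I$. An abelian ideal is an upper ideal $I$ with $\gamma'+\gamma''\notin\Delta^+$ for all $\gamma',\gamma''\in I$. For $\gamma\in\Delta^+$ put $I\langle\succcurlyeq\gamma\rangle=\{\nu\in\Delta^+\mid\nu\succcurlyeq\gamma\}$. It is known that for any $\mu_1,\mu_2\in\Delta^+$ there is a unique minimal root $\mu\in\Delta^+$ with $\mu\succcurlyeq\mu_1$ and $\mu\succcurlyeq\mu_2$; it is denoted $\mu_1\vee\mu_2$. Rootlets. Let $V$ be the real span of $\Delta$ and consider $V\oplus\mathbb R\delta$. The real affine roots are $\gamma+k\delta$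 ($\gamma\in\Delta$, $k\in\mathbb Z$); the positive ones $\widehat\Delta^+$ are those with $k\ge 1$, or $k=0$ and $\gamma\in\Delta^+$. The affine Weyl group $\widehat W$ is generated by the reflections $s_{\gamma+k\delta}$, acting by $s_{\gamma+k\delta}(\beta+m\delta)=s_\gamma(\beta)+(m-k\langle\beta,\gamma^\vee\rangle)\delta$ (so $\widehat W$ fixes $\delta$). For $w\in\widehat W$ let $N(w)=\{\nu\in\widehat\Delta^+\mid w(\nu)\in-\widehat\Delta^+\}$. It is known (Peterson) that for each abelian ideal $I$ there is a unique $w_I\in\widehat W$ with $N(w_I)=\{\delta-\gamma\mid\gamma\in I\}$. For a nonempty abelian ideal $I$, its rootlet is $\mathrm{rt}(I)=w_I(2\delta-\theta)$; it is known to be an element of $\Delta^+_l$, and every element of $\Delta^+_l$ is the rootlet of some nonempty abelian ideal. For $\mu\in\Delta^+_l$, the set of nonempty abelian ideals with rootlet $\mu$, ordered by inclusion, is known to have a unique maximal element, denoted $I(\mu)_{\max}$. A root $\gamma\in\Delta^+_l$ is amazing if $I(\gamma)_{\max}=I\langle\succcurlyeq\gamma\rangle$; $\mathcal A$ is the set of amazing roots. An amazing root $\gamma$ is primitive if it cannot be written as $\gamma_1\vee\gamma_2$ with $\gamma_1,\gamma_2$ amazing and incomparable (i.e. $\gamma_1\not\preccurlyeq\gamma_2$ and $\gamma_2\not\preccurlyeq\gamma_1$). *)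

(* Defs.v *)
From HB Require Import structures.
From mathcomp Require Import all_boot all_order all_algebra finmap.
From mathcomp Require Import boolp classical_sets functions cardinality reals.

Set Implicit Arguments.
Unset Strict Implicit.
Unset Printing Implicit Defensive.
Import Order.TTheory GRing.Theory Num.Theory.

Local Open Scope classical_set_scope.
Local Open Scope ring_scope.

Section RootSystems.
Variables (R : realType) (V : vectType R) (form : {dot V for idfun}).

(* The pairing <b, a^\vee> = 2 (b, a) / (a, a). *)
Definition coroot_pairing (b a : V) : R := 2 * form b a / form a a.

Definition reflection (a b : V) : V := b - coroot_pairing b a *: a.

Record root_system (Delta : {fset V}) : Prop := RootSystem {
  root_span : <<Delta>>%VS = fullv;
  root_neq0 : 0 \notin Delta;
  root_reflection : forall a b, a \in Delta -> b \in Delta ->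
    reflection a b \in Delta;
  root_crystallographic : forall a b, a \in Delta -> b \in Delta ->
    coroot_pairing b a \is a Num.int;
  root_reduced : forall a (c : R), a \in Delta -> c *: a \in Delta ->
    c = 1 \/ c = -1
}.

Definition irreducible_root_system (Delta : {fset V}) : Prop :=
  [/\ root_system Delta, Delta != fset0 &
      forall A B : {fset V}, Delta = (A `|` B)%fset ->
        (forall a b, a \in A -> b \in B -> form a b = 0) ->
        A = fset0 \/ B = fset0].

Variables (Delta Pi : {fset V}).

Definition nneg_comb (v : V) : Prop :=
  exists c : V -> nat, v = \sum_(a <- Pi) a *+ c a.

Definition simple_system : Prop :=
  [/\ (Pi `<=` Delta)%fset, basis_of fullv Pi &
      forall b, b \in Delta -> nneg_comb b \/ nneg_comb (- b)].

Definition pos_roots : set V := [set b | b \in Delta /\ nneg_comb b].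

Definition root_le (mu nu : V) : Prop := nneg_comb (nu - mu).

Definition highest_root (theta : V) : Prop :=
  pos_roots theta /\ forall nu, pos_roots nu -> root_le nu theta.

(* Long roots are those of maximal length, so every root is long in the
   simply-laced case. *)
Definition long_pos_roots : set V :=
  [set g | pos_roots g /\ forall b, b \in Delta -> form b b <= form g g].

Definition upper_ideal (I : set V) : Prop :=
  I `<=` pos_roots /\
  forall nu g, I nu -> pos_roots g -> root_le nu g -> I g.

Definition abelian_ideal (I : set V) : Prop :=
  upper_ideal I /\ forall g1 g2, I g1 -> I g2 -> ~ pos_roots (g1 + g2).

Definition upper_cone (g : V) : set V :=
  [set nu | pos_roots nu /\ root_le g nu].

Definition upper_bound2 (mu1 mu2 : V) : set V :=
  [set nu | [/\ pos_roots nu, root_le mu1 nu & root_le mu2 nu]].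

(* [is_join mu1 mu2 mu] means mu = mu1 \vee mu2. *)
Definition is_join (mu1 mu2 mu : V) : Prop :=
  upper_bound2 mu1 mu2 mu /\
  forall nu, upper_bound2 mu1 mu2 nu -> root_le nu mu -> nu = mu.

(* The pair (v, c) : V * R stands for v + c delta in V (+) R delta. *)

Definition pos_affine_roots : set (V * R) :=
  [set x | exists g (k : int), [/\ x = (g, k%:~R), g \in Delta &
             1 <= k \/ (k = 0 /\ pos_roots g)]].

(* The reflection s_{g + k delta}. *)
Definition affine_reflection (g : V) (k : int) (x : V * R) : V * R :=
  (reflection g x.1, x.2 - k%:~R * coroot_pairing x.1 g).

(* Affine reflections are involutions, so the group they generate consists of
   their finite compositions. *)
Inductive affine_weyl : (V * R -> V * R) -> Prop :=
| affine_weyl_id : affine_weyl id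
| affine_weyl_comp (g : V) (k : int) (w : V * R -> V * R) :
    g \in Delta -> affine_weyl w -> affine_weyl (affine_reflection g k \o w).

Definition inversion_set (w : V * R -> V * R) : set (V * R) :=
  [set nu | pos_affine_roots nu /\ pos_affine_roots (- w nu)].

(* [is_rootlet theta I mu] means mu = rt(I) for a nonempty abelian ideal I and
   the highest root theta. The element w is unique (Peterson), so this relation
   is functional in I. *)
Definition is_rootlet (theta : V) (I : set V) (mu : V) : Prop :=
  [/\ abelian_ideal I, I !=set0 &
      exists w, [/\ affine_weyl w,
                    inversion_set w = [set (- g, 1 : R) | g in I] &
                    w (- theta, 2 : R) = (mu, 0)]].

(* [is_Imax theta mu I] means I = I(mu)_max. *)
Definition is_Imax (theta mu : V) (I : set V) : Prop :=
  is_rootlet theta I mu /\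
  forall J, is_rootlet theta J mu -> I `<=` J -> J = I.

Definition amazing (theta : V) : set V :=
  [set g | long_pos_roots g /\ is_Imax theta g (upper_cone g)].

Definition primitive_amazing (theta : V) : set V :=
  [set g | amazing theta g /\
     ~ exists g1 g2, [/\ amazing theta g1, amazing theta g2,
                         ~ root_le g1 g2, ~ root_le g2 g1 &
                         is_join g1 g2 g]].

End RootSystems.

(* Main.v *)
(** Fix coordinates with respect to the simple affine roots [a_0 = delta - theta]
    and [a_i], so that every positive affine root has height at least 1.  Suppose
    that [w] inverts exactly [delta - J], that [gamma] is in [J], and that
    [w (2 delta - theta) = gamma].  Then [w a_0 = - (delta - gamma)], and expanding
    [delta - gamma = a_0 + sum_i (n_i - g_i) a_i] (with [n], [g] the coefficients
    of [theta], [gamma]) gives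
    [w (delta - gamma) = - (delta - gamma) + sum_i (n_i - g_i) w a_i].  The
      left side
    is negative and the [w a_i] are positive, so comparing heights forces
    [w a_i] to have height 1 whenever [g_i < n_i], and [w (delta - gamma)] to have
    height -1.  If moreover [gamma - a_i] is a root or 0 with [g_i < n_i], then
    [w (delta - gamma + a_i)] has height 0, which is absurd.  So an amazing root has
    maximal coefficient at every simple root that can be subtracted from it, and is
    thus the least root [gamma_S] with maximal coefficients on a nonempty set [S]
    of simple roots.

    Conversely every [gamma_S] is amazing: it is the image of [theta] under the
    longest element [w1] of the parabolic subgroup generated outside [S], and its
    cone is the ideal encoded by [w2 w1] with [w2] the longest element of the
    parabolic subgroup of the affine Weyl group generated by [a_0] and the [a_i],
    [i] outside [S].  Since [gamma_S] and [gamma_T] have join [gamma_(S u T)], the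
    primitive amazing roots are the [gamma_{i}], and [a_i] is the only simple root
    that can be subtracted from [gamma_{i}]. *)

Require Import Defs.
From HB Require Import structures.
From mathcomp Require Import all_boot all_order all_algebra finmap.
From mathcomp Require Import boolp classical_sets functions cardinality reals.
From mathcomp Require Import ring lra.

Set Implicit Arguments.
Unset Strict Implicit.
Unset Printing Implicit Defensive.
Import Order.TTheory GRing.Theory Num.Theory.

Local Open Scope classical_set_scope.
Local Open Scope ring_scope.

(** * Reflections, and sums and differences of roots *)

Section RootTheory.
Variables (R : realType) (V : vectType R) (form : {dot V for idfun}).

Lemma form_sym u v : form u v = form v u.
Proof. by rewrite hermC expr0 mul1r. Qed.

Lemma form_gt0 u : u != 0 -> 0 < form u u.
Proof. exact: neq0_dnorm_gt0. Qed.

Lemma formB u v : form (u - v) (u - v) = form u u - form u v *+ 2 + form v v.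
Proof. by rewrite hnormB expr0 mul1r /=; ring. Qed.

Lemma coroot_pairing_additive a : additive (coroot_pairing form ^~ a).
Proof. by move=> u v; rewrite /coroot_pairing linearBl mulrBr mulrBl. Qed.

Lemma coroot_pairingZ a c u :
  coroot_pairing form (c *: u) a = c * coroot_pairing form u a.
Proof. by rewrite /coroot_pairing linearZl_LR /=; ring. Qed.

Lemma coroot_pairing_self a : a != 0 -> coroot_pairing form a a = 2.
Proof. by move=> /form_gt0 a0; rewrite /coroot_pairing mulfK // gt_eqF. Qed.

Lemma reflection_self a : a != 0 -> reflection form a a = - a.
Proof.
move=> a0; rewrite /reflection coroot_pairing_self // scaler_nat mulr2n.
by rewrite opprD addrA subrr sub0r.
Qed.

Lemma form_reflection a u v : a != 0 ->
  form (reflection form a u) (reflection form a v) = form u v.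
Proof.
move=> /form_gt0 a0; rewrite /reflection !linearBl !linearBr.
rewrite !linearZl_LR !linearZ_LR /= /coroot_pairing (form_sym a v).
by field; rewrite gt_eqF.
Qed.

Lemma reflectionK a : a != 0 -> involutive (reflection form a).
Proof.
move=> a0 u; rewrite {1}/reflection coroot_pairing_additive coroot_pairingZ.
rewrite coroot_pairing_self // /reflection -addrA -opprD -scalerDl.
set p := coroot_pairing _ _ _.
have -> : p + (p - p * 2) = 0 by ring.
by rewrite scale0r subr0.
Qed.

Variable Delta : {fset V}.
Hypothesis rsD : root_system form Delta.

Lemma root_nz a : a \in Delta -> a != 0.
Proof. by move=> aD; apply: contraTneq aD => ->; case: rsD. Qed.

Lemma root_opp a : a \in Delta -> - a \in Delta.
Proof.
move=> aD; rewrite -(reflection_self (root_nz aD)).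
exact: (root_reflection rsD).
Qed.

(** If one of the two positive integral pairings is 1, a reflection gives the difference up to sign.
    Otherwise both are at least 2, so [form a b] bounds both squared lengths and a - b would have
    norm at most 0. *)
Lemma root_sub a b : a \in Delta -> b \in Delta -> 0 < form a b -> a != b ->
  a - b \in Delta.
Proof.
have pos_int u v : u \in Delta -> v \in Delta -> 0 < form u v ->
    coroot_pairing form u v = 1 \/ form v v <= form u v.
  move=> uD vD uv0; have vv0 := form_gt0 (root_nz vD).
  have p0 : 0 < coroot_pairing form u v.
    by rewrite /coroot_pairing divr_gt0 // mulr_gt0.
  have /intrP[m pm] := root_crystallographic rsD vD uD.
  have m0 : 0 < m by move: p0; rewrite pm ltr0z.
  have [m1|m1] := eqVneq m 1; first by left; rewrite pm m1.
  have m2 : 2 <= m by rewrite -[2]/(1 + 1) lezD1 lt_neqAle eq_sym m1 -gtz0_ge1.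
  right; have : 2 <= coroot_pairing form u v by rewrite pm (ler_int R 2).
  by rewrite /coroot_pairing ler_pdivlMr // ler_pM2l.
move=> aD bD ab0 neq.
have [p1|bb] := pos_int _ _ aD bD ab0.
  have := root_reflection rsD bD aD; by rewrite /reflection p1 scale1r.
have [p1|aa] := pos_int _ _ bD aD (eq_ind _ (fun x => 0 < x) ab0 _ (form_sym a b)).
  have := root_opp (root_reflection rsD aD bD).
  by rewrite /reflection p1 scale1r opprB.
have /form_gt0 : a - b != 0 by rewrite subr_eq0.
rewrite (form_sym b a) in aa; rewrite formB; lra.
Qed.

Lemma root_add a b : a \in Delta -> b \in Delta -> form a b < 0 -> a != - b ->
  a + b \in Delta.
Proof.
move=> aD bD ab neq; rewrite -[b]opprK; apply: root_sub => //.
  exact: root_opp.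
by rewrite linearNr oppr_gt0.
Qed.

End RootTheory.

(** * Coordinates along the simple roots, and the root order *)

Section Coordinates.
Variables (R : realType) (V : vectType R) (form : {dot V for idfun}).
Variables (Delta Pi : {fset V}).
Hypotheses (rsD : root_system form Delta) (ssP : simple_system Delta Pi).

Local Notation node := 'I_(size (enum_fset Pi)).
Local Notation coef := (coord (in_tuple (enum_fset Pi))).
Local Notation simple i := ((enum_fset Pi)`_(nat_of_ord i)).
Local Notation pos := (pos_roots Delta Pi).

Lemma simple_in (i : node) : simple i \in Pi.
Proof. exact: mem_nth. Qed.

Lemma simpleP a : a \in Pi -> exists i : node, a = simple i.
Proof.
move=> aP; have lt : (index a Pi < size (enum_fset Pi))%N by rewrite index_mem.
by exists (Ordinal lt); rewrite nth_index.
Qed.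

Lemma simple_root (i : node) : simple i \in Delta.
Proof. by case: ssP => /fsubsetP sub _ _; apply/sub/simple_in. Qed.

Lemma coef_simple (i j : node) : coef j (simple i) = (i == j)%:R.
Proof. by case: ssP => _ /basis_free fr _; apply: (coord_free (X :=
  in_tuple _)). Qed.

Lemma coefK v : v = \sum_(i : node) coef i v *: simple i.
Proof. by case: ssP => _ bs _; apply: (coord_basis (X :=
  in_tuple _) bs (memvf v)). Qed.

Lemma coef_inj u v : (forall i : node, coef i u = coef i v) -> u = v.
Proof. by move=> e; rewrite (coefK u) (coefK v); apply: eq_bigr => i _;
  rewrite e. Qed.

Lemma simple_inj : injective (fun i : node => simple i).
Proof.
move=> i j /(congr1 (coef j)); rewrite !coef_simple eqxx.
by case: eqP => // _ /eqP; rewrite eq_sym oner_eq0.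
Qed.

Lemma nneg_combP v : nneg_comb Pi v <-> forall i : node, coef i v \is a Num.nat.
Proof.
have sumE (c : V -> nat) :
    \sum_(a <- Pi) a *+ c a = \sum_(i : node) (c (simple i))%:R *: simple i.
  by rewrite (big_nth 0) big_mkord; apply: eq_bigr => i _; rewrite scaler_nat.
split=> [[c ->] i|vN].
  rewrite sumE linear_sum (bigD1 i) //= linearZ /= coef_simple eqxx mulr1.
  rewrite big1 ?addr0 ?natr_nat // => j /negbTE ji.
  by rewrite linearZ /= coef_simple ji mulr0.
(* The multiplicity has to be a function on all of [V], so the node is recovered from the vector;
   the default 0 is taken only outside [Pi]. *)
exists (fun a => if insub (index a (enum_fset Pi)) is Some i
                 then Num.truncn (coef i v) else 0%N).
rewrite sumE {1}(coefK v); apply: eq_bigr => i _.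
rewrite index_uniq ?fset_uniq // valK truncnK //; exact: vN.
Qed.

Lemma root_sign b : b \in Delta ->
  (forall i : node, coef i b \is a Num.nat) \/
  (forall i : node, coef i (- b) \is a Num.nat).
Proof. by case: ssP => _ _ sg /sg; rewrite !nneg_combP. Qed.

Lemma coef_int b i : b \in Delta -> coef i b \is a Num.int.
Proof.
by move=> /root_sign[/(_ i)|/(_ i)]; rewrite natrEint => /andP[];
  rewrite // linearN rpredN.
Qed.

Lemma nat_ge0 (x : R) : x \is a Num.int -> (x \is a Num.nat) = (0 <= x).
Proof. by move=> xZ; rewrite natrEint xZ. Qed.

Lemma posP b : b \in Delta -> pos b <-> forall i : node, 0 <= coef i b.
Proof.
move=> bD; split=> [[_ /nneg_combP bN] i|b0]; first exact: natr_ge0.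
by split=> //; apply/nneg_combP => i; rewrite nat_ge0 ?coef_int.
Qed.

Lemma posD b : pos b -> b \in Delta. Proof. by case. Qed.

Lemma pos_coef b i : pos b -> 0 <= coef i b.
Proof. by move=> b0; have /posP := posD b0; case=> /(_ b0). Qed.

Lemma pos_or_opp b : b \in Delta -> pos b \/ pos (- b).
Proof.
move=> bD; have nbD := root_opp rsD bD.
by case: (root_sign bD) => bN; [left|right]; split=> //; apply/nneg_combP.
Qed.

Lemma simple_pos (i : node) : pos (simple i).
Proof.
by apply/posP=> [|j]; [exact: simple_root | rewrite coef_simple ler0n].
Qed.

Lemma pos_coef_gt0 b : pos b -> exists i : node, 0 < coef i b.
Proof.
move=> b0; have [//|no] := pselect (exists i : node, 0 < coef i b).
have /eqP[] := root_nz rsD (posD b0); apply: coef_inj => i; rewrite linear0.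
apply/eqP; apply: contra_notT no => nz; exists i.
by rewrite lt_def nz pos_coef.
Qed.

Lemma root_pos b i : b \in Delta -> 0 < coef i b -> pos b.
Proof.
move=> bD bi; have [//|/pos_coef-/(_ i)] := pos_or_opp bD.
by rewrite linearN oppr_ge0 leNgt bi.
Qed.

Lemma root_leP u v : u \in Delta -> v \in Delta ->
  root_le Pi u v <-> forall i : node, coef i u <= coef i v.
Proof.
move=> uD vD; rewrite /root_le nneg_combP.
split=> le i; have := le i;
  rewrite linearB /= nat_ge0 ?subr_ge0 ?rpredB ?coef_int //.
Qed.

Lemma root_le_anti u v : u \in Delta -> v \in Delta ->
  root_le Pi u v -> root_le Pi v u -> u = v.
Proof.
move=> uD vD /root_leP-/(_ uD vD) uv /root_leP-/(_ vD uD) vu.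
by apply: coef_inj => i; apply/eqP; rewrite eq_le uv vu.
Qed.

Lemma root_le_trans u v w : root_le Pi u v -> root_le Pi v w -> root_le Pi u w.
Proof.
move=> /nneg_combP uv /nneg_combP vw; apply/nneg_combP => i.
by rewrite -(subrK v w) -addrA linearD rpredD ?vw ?uv.
Qed.

Lemma root_le_refl u : root_le Pi u u.
Proof. by apply/nneg_combP => i; rewrite subrr linear0 rpred0. Qed.

Lemma coef_simple_ge0 (i j : node) : 0 <= coef j (simple i).
Proof. exact/pos_coef/simple_pos. Qed.

(* [mu = 0] covers the existence of a simple root that can be subtracted. *)
Lemma root_descent mu nu : mu = 0 \/ pos mu -> pos nu -> mu != nu ->
  (forall i : node, coef i mu <= coef i nu) ->
  exists i : node, (pos (nu - simple i) \/ nu - simple i = 0) /\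
    forall j : node, coef j mu <= coef j (nu - simple i).
Proof.
move=> + nu0; have nuD := posD nu0.
pose ht v := \sum_(i : node) coef i v.
(* Induction on a natural bound for the height of nu - mu, raising mu by one simple root at a
   time. *)
have [m] : exists m : nat, ht (nu - mu) <= m%:R.
  by exists (Num.truncn (ht (nu - mu))).+1; rewrite ltW // truncnS_gt.
elim: m mu => [|m IH] mu htm mu0 neq le.
  have x0 i : 0 <= coef i (nu - mu) by rewrite linearB subr_ge0 le.
  have /eqP[] := neq; apply/esym/eqP; rewrite -subr_eq0; apply/eqP/coef_inj => i.
  rewrite linear0; apply/eqP; rewrite eq_le x0 andbT.
  by apply: le_trans htm; rewrite /ht (bigD1 i) //= lerDl sumr_ge0.
have muD_or : mu = 0 \/ mu \in Delta by case: mu0 => [|/posD]; [left|right].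
have muZ i : coef i mu \is a Num.int.
  by case: muD_or => [->|muD]; rewrite ?linear0 ?rpred0 ?coef_int.
(* Expanding one argument of the positive norm of nu - mu along the simple roots, some term must be
   positive. *)
have [i xi xa] : exists2 i :
  node, 0 < coef i (nu - mu) & 0 < form (nu - mu) (simple i).
  apply: contrapT => no; have : 0 < form (nu - mu) (nu - mu).
    by rewrite form_gt0 // subr_eq0 eq_sym.
  rewrite [X in form _ X](coefK (nu - mu)) linear_sumr /= ltNge => /negP[].
  apply: sumr_le0 => i _; rewrite linearZ_LR /=.
  have : 0 <= coef i (nu - mu) by rewrite linearB subr_ge0 le.
  rewrite le_eqVlt => /predU1P[<-|xi]; first by rewrite mul0r.
  rewrite mulr_ge0_le0 ?(ltW xi) // leNgt; apply: contra_notN no => xa; by exists i.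
have step : forall j : node, coef j (mu + simple i) <= coef j nu.
  move=> j; rewrite linearD /= coef_simple; case: eqP => [<-|_];
    last by rewrite addr0.
  move: xi; rewrite linearB /= => xi; rewrite -lerBrDl.
  have xN : coef i nu - coef i mu \is a Num.nat.
    by rewrite nat_ge0 ?ltW // rpredB ?muZ ?coef_int.
  by have /natrP[k ek] := xN; rewrite ek in xi *; rewrite ltr0n in xi;
    rewrite ler1n.
(* Since (nu - mu, a_i) > 0, either (nu, a_i) > 0 and a_i can be subtracted from nu, or (mu, a_i) <
   0 and mu + a_i is a root closer to nu. *)
have [nua|nua] := ltP 0 (form nu (simple i)).
  exists i; split=> [|j]; last by rewrite linearB lerBrDr -linearD step.
  have [->|ne] := eqVneq nu (simple i); first by right; rewrite subrr.
  left; apply/posP => [|j]; first exact: (root_sub rsD nuD (simple_root i) nua ne).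
  apply: (le_trans (y := coef j mu)).
    by case: mu0 => [->|/pos_coef//]; rewrite linear0.
  by rewrite linearB lerBrDr -linearD step.
have mua : form mu (simple i) < 0.
  by move: xa; rewrite linearBl subr_gt0 => /lt_le_trans; apply.
have mup : pos mu by case: mu0 mua => // ->; rewrite linear0l ltxx.
have muaD : mu + simple i \in Delta.
  apply: (root_add rsD (posD mup) (simple_root i) mua).
  apply/eqP => e; have := pos_coef i mup; rewrite e linearN /= coef_simple eqxx.
  by rewrite oppr_ge0 ler10.
have [e|ne] := eqVneq (mu + simple i) nu.
  by exists i; rewrite -e addrK; split; [left|].
have muap : pos (mu + simple i).
  by apply/posP => // j; rewrite linearD /= addr_ge0 ?coef_simple_ge0 ?pos_coef.
have htm' : ht (nu - (mu + simple i)) <= m%:R.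
  have -> : ht (nu - (mu + simple i)) = ht (nu - mu) - ht (simple i).
    by rewrite /ht -sumrB; apply: eq_bigr => j _; rewrite opprD addrA linearB.
  have -> : ht (simple i) = 1.
    rewrite /ht (bigD1 i) //= coef_simple eqxx big1 ?addr0 // => j ji.
    by rewrite coef_simple eq_sym (negbTE ji).
  by rewrite lerBlDr natr1.
have [k [kpos kle]] := IH _ htm' (or_intror muap) ne step.
exists k; split=> // j; apply: le_trans (kle j).
by rewrite linearD /= lerDl coef_simple_ge0.
Qed.

End Coordinates.

(** * Affine roots and their coordinates along the simple affine roots *)

Section AffineRoots.
Variables (R : realType) (V : vectType R) (form : {dot V for idfun}).
Variables (Delta Pi : {fset V}) (theta : V).
Hypotheses (rsD : root_system form Delta) (ssP : simple_system Delta Pi).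
Hypothesis highest_theta : highest_root Delta Pi theta.

Local Notation node := 'I_(size (enum_fset Pi)).
Local Notation coef := (coord (in_tuple (enum_fset Pi))).
Local Notation simple i := ((enum_fset Pi)`_(nat_of_ord i)).
Local Notation pos := (pos_roots Delta Pi).
Local Notation apos := (pos_affine_roots Delta Pi).
Local Notation weyl := (affine_weyl form Delta).

Lemma theta_pos : pos theta. Proof. by case: highest_theta. Qed.
Let thetaD : theta \in Delta := posD theta_pos.

Lemma pos_le_theta b i : pos b -> coef i b <= coef i theta.
Proof.
move=> b0; have [_ /(_ _ b0)] := highest_theta.
by move=> /(root_leP ssP (posD b0) thetaD); apply.
Qed.

Lemma theta_ge1 (i : node) : 1 <= coef i theta.
Proof.
by have := pos_le_theta i (simple_pos ssP i); rewrite (coef_simple ssP) eqxx.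
Qed.

Lemma root_coef_bound b i : b \in Delta -> `|coef i b| <= coef i theta.
Proof.
have neg c : pos c -> - coef i c <= coef i theta.
  move=> c0; rewrite (le_trans _ (le_trans ler01 (theta_ge1 i))) //.
  by rewrite oppr_le0 (pos_coef ssP).
move=> bD; rewrite ler_norml lerNl.
have [b0|b0] := pos_or_opp rsD ssP bD.
  by rewrite neg // pos_le_theta.
by rewrite -[X in _ && (X <= _)]opprK -linearN pos_le_theta //= neg.
Qed.

(* The simple affine roots are [theta] negated plus delta ([None]) and the
   [a_i] ([Some i]); [acoef] is the dual basis of coordinates. *)
Definition sroot (i : option node) : V * R :=
  if i is Some i then (simple i, 0) else (- theta, 1).

Definition acoef (i : option node) (x : V * R) : R :=
  if i is Some i then coef i x.1 + x.2 * coef i theta else x.2.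

Definition aheight (x : V * R) : R := \sum_i acoef i x.

Definition affine_root (x : V * R) : Prop := x.1 \in Delta /\ x.2 \is a Num.int.

Lemma acoefD i x y : acoef i (x + y) = acoef i x + acoef i y.
Proof. by case: i => [i|] //=; rewrite linearD /=; ring. Qed.

Lemma acoefN i x : acoef i (- x) = - acoef i x.
Proof. by case: i => [i|] //=; rewrite linearN /=; ring. Qed.

Lemma acoefZ i (c : R) (x : V * R^o) : acoef i (c *: x) = c * acoef i x.
Proof. by case: i => [i|] //=; rewrite linearZ /= -[c *: x.2]/(c * x.2); ring. Qed.

Lemma acoef0 i : acoef i 0 = 0.
Proof. by case: i => [i|] //=; rewrite linear0 mul0r addr0. Qed.

Lemma acoef_sum (I : finType) (F : I -> V * R) i :
  acoef i (\sum_k F k) = \sum_k acoef i (F k).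
Proof. exact: (big_morph (acoef i) (acoefD i) (acoef0 i)). Qed.

Lemma acoef_inj x y : (forall i, acoef i x = acoef i y) -> x = y.
Proof.
case: x y => [u c] [v d] e; have /= cd := e None; rewrite cd in e *.
by congr (_, _); apply: (coef_inj ssP) => i; have /= /addIr := e (Some i).
Qed.

Lemma acoef_sroot i j : acoef j (sroot i) = (i == j)%:R.
Proof.
case: i j => [i|] [j|] //=; rewrite ?mul0r ?addr0 //.
  exact: (coef_simple ssP).
by rewrite linearN mul1r addNr.
Qed.

Lemma aheightD x y : aheight (x + y) = aheight x + aheight y.
Proof. by rewrite -big_split; apply: eq_bigr => i _; rewrite acoefD. Qed.

Lemma aheightN x : aheight (- x) = - aheight x.
Proof. by rewrite -sumrN; apply: eq_bigr => i _; rewrite acoefN. Qed.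

Lemma acoef_int i x : affine_root x -> acoef i x \is a Num.int.
Proof.
case=> xD xZ; case: i => [i|] //=.
by rewrite rpredD ?rpredM ?(coef_int ssP).
Qed.

Lemma affine_rootN x : affine_root x -> affine_root (- x).
Proof. by case=> xD xZ; split; rewrite /= ?rpredN // (root_opp rsD). Qed.

Lemma apos_affine_root x : apos x -> affine_root x.
Proof. by case=> [g [k [-> gD _]]]; split; rewrite ?rpred_int. Qed.

(** A root has coefficients bounded by the n_i in absolute value, so a level k >= 1 makes every g_i
    + k n_i nonnegative. Conversely the coordinate at [None] is k, and at k = 0 the others are the
    coefficients of the finite part. *)
Lemma aposP x : affine_root x -> apos x <-> forall i, 0 <= acoef i x.
Proof.
move=> [xD /intrP[k xk]]; split=> [[g [m [-> gD cases]]] i|x0].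
  case: cases => [m1|[-> g0]]; last first.
    by case: i => [i|] //=; rewrite mul0r addr0 (pos_coef ssP).
  have m1R : 1 <= m%:~R :> R by rewrite ler1z.
  case: i => [i|] /=; last exact: le_trans m1R.
  have := root_coef_bound i gD; rewrite ler_norml => /andP[lo _].
  rewrite -lerBlDl sub0r lerNl; apply: (le_trans (y := - coef i theta)); last by [].
  by rewrite lerN2 ler_peMl // (le_trans ler01 (theta_ge1 i)).
exists x.1, k; split=> //; first by rewrite -xk; case: (x).
have := x0 None; rewrite /= xk ler0z le_eqVlt => /predU1P[k0|k1]; last by left.
right; split=> //; apply/(posP ssP xD) => i.
by have /= := x0 (Some i); rewrite xk -k0 mul0r addr0.
Qed.

Lemma apos_acoef i x : apos x -> 0 <= acoef i x.
Proof. by move=> x0; have /aposP := apos_affine_root x0; case=> /(_ x0). Qed.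

Lemma apos_or_opp x : affine_root x -> apos x \/ apos (- x).
Proof.
move=> [xD /intrP[k xk]]; have nD := root_opp rsD xD.
have xE : x = (x.1, k%:~R) by rewrite -xk; case: (x).
have nE : - x = (- x.1, (- k)%:~R) by rewrite intrN -xk; case: (x).
have [k0|k0|k0] := ltgtP k 0.
- right; exists (- x.1), (- k); split=> //; left.
  by rewrite -gtz0_ge1 oppr_gt0.
- by left; exists x.1, k; split=> //; left; rewrite -gtz0_ge1.
have [x0|x0] := pos_or_opp rsD ssP xD.
  by left; exists x.1, k; split=> //; right.
by right; exists (- x.1), (- k); split=> //; right; rewrite k0 oppr0.
Qed.

Lemma apos_coef_gt0 x : apos x -> exists i, 0 < acoef i x.
Proof.
move=> x0; apply: contrapT => no.
have x00 i : acoef i x = 0.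
  apply/eqP; apply: contra_notT no => nz; exists i.
  by rewrite lt_def nz apos_acoef.
have [xD _] := apos_affine_root x0; have /eqP[] := root_nz rsD xD.
apply: (coef_inj ssP) => i; rewrite linear0.
by have /= := x00 (Some i); rewrite [x.2](x00 None) mul0r addr0.
Qed.

Lemma affine_root_apos x i : affine_root x -> 0 < acoef i x -> apos x.
Proof.
move=> xD xi; have [//|/apos_acoef-/(_ i)] := apos_or_opp xD.
by rewrite acoefN oppr_ge0 leNgt xi.
Qed.

Lemma int_gt0_ge1 (c : R) : c \is a Num.int -> 0 < c -> 1 <= c.
Proof.
by move=> /intrP[k ->]; rewrite ltr0z ler1z -gtz0_ge1.
Qed.

Lemma aheight_ge1 x : apos x -> 1 <= aheight x.
Proof.
move=> x0; have [i xi] := apos_coef_gt0 x0.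
rewrite /aheight (bigD1 i) //= -[1]addr0 lerD ?sumr_ge0 // => [|j _].
  by rewrite int_gt0_ge1 ?acoef_int //; apply: apos_affine_root.
exact: apos_acoef.
Qed.

Lemma sroot_affine i : affine_root (sroot i).
Proof.
case: i => [i|]; split=> //=; rewrite ?rpred0 ?rpred1 ?(simple_root ssP) //.
exact: (root_opp rsD).
Qed.

Lemma sroot_apos i : apos (sroot i).
Proof. by apply/aposP => [|j];
  [exact: sroot_affine | rewrite acoef_sroot ler0n]. Qed.

Lemma acoefK (x : V * R^o) : x = \sum_i acoef i x *: (sroot i : V * R^o).
Proof.
apply: acoef_inj => j;
  rewrite acoef_sum (bigD1 j) //= acoefZ acoef_sroot eqxx mulr1.
by rewrite big1 ?addr0 // => i /negbTE ij; rewrite acoefZ acoef_sroot ij mulr0.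
Qed.

(** * Linearity and invariants of the affine Weyl group action *)

(** The type [R^o] views the scalars as a module over themselves, so that pairs can be scaled.
    Linearity reduces [w] to its values on the simple affine roots. *)
Lemma weyl_linear w : weyl w -> forall (c : R) (x y : V * R^o),
  w (c *: x + y) = c *: (w x : V * R^o) + w y.
Proof.
elim=> [//|g k {}w gD _ IH] c x y; rewrite /= IH.
rewrite /affine_reflection /reflection /=.
have -> : coroot_pairing form (c *: (w x).1 + (w y).1) g =
    c * coroot_pairing form (w x).1 g + coroot_pairing form (w y).1 g.
  by rewrite /coroot_pairing linearDl linearZl_LR /=; ring.
set p := coroot_pairing form (w x).1 g; set q := coroot_pairing form (w y).1 g.
congr (_, _); last first.
  change (c * (w x).2 + (w y).2 - k%:~R * (c * p + q) =
    c * ((w x).2 - k%:~R * p) + ((w y).2 - k%:~R * q)).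
  by ring.
by rewrite /= scalerDl -scalerA scalerBr opprD addrACA.
Qed.

Lemma weyl0 w : weyl w -> w 0 = 0.
Proof.
move=> wW; have := weyl_linear wW (-1) 0 0.
by rewrite !scaleN1r oppr0 add0r addNr.
Qed.

Lemma weylZ w (c : R) (x : V * R^o) : weyl w -> w (c *: x) = c *: (w x : V * R^o).
Proof. by move=> wW; have := weyl_linear wW c x 0; rewrite (weyl0 wW) !addr0. Qed.

Lemma weylN w x : weyl w -> w (- x) = - w x.
Proof. by move=> wW; have := weylZ (-1) x wW; rewrite !scaleN1r. Qed.

Lemma weylD w x y : weyl w -> w (x + y) = w x + w y.
Proof. by move=> wW; have := weyl_linear wW 1 x y; rewrite !scale1r. Qed.

Lemma weyl_acoef w x j : weyl w ->
  acoef j (w x) = \sum_i acoef i x * acoef j (w (sroot i)).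
Proof.
move=> wW; rewrite {1}[x]acoefK.
rewrite (big_morph w (fun x y => weylD x y wW) (weyl0 wW)) acoef_sum.
by apply: eq_bigr => i _; rewrite weylZ // acoefZ.
Qed.

Lemma weyl_aheight w x : weyl w ->
  aheight (w x) = \sum_i acoef i x * aheight (w (sroot i)).
Proof.
move=> wW; rewrite /aheight; under eq_bigr do rewrite weyl_acoef //.
by rewrite exchange_big; apply: eq_bigr => i _; rewrite mulr_sumr.
Qed.

Lemma weyl_delta w c : weyl w -> w (0, c) = (0, c).
Proof.
elim=> [//|g k {}w gD _ IH] /=; rewrite IH /affine_reflection /=.
have -> : coroot_pairing form 0 g = 0.
  by rewrite /coroot_pairing linear0l mulr0 mul0r.
by rewrite /reflection /coroot_pairing linear0l !mulr0 mul0r scale0r !subr0.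
Qed.

Lemma weyl_affine_root w x : weyl w -> affine_root x -> affine_root (w x).
Proof.
elim=> [//|g k {}w gD _ IH] /= /IH[xD xZ]; split=> /=.
  exact: root_reflection rsD _ _ gD xD.
rewrite rpredB // rpredM ?rpred_int //; exact: (root_crystallographic rsD).
Qed.

Lemma weyl_form w x y : weyl w -> form (w x).1 (w y).1 = form x.1 y.1.
Proof.
by elim=> [//|g k {}w gD _ IH] /=; rewrite form_reflection ?(root_nz rsD).
Qed.

Lemma affine_reflectionK g k : g \in Delta ->
  involutive (affine_reflection form g k).
Proof.
move=> gD [u c]; have g0 := root_nz rsD gD; congr (_, _); first exact: reflectionK.
rewrite /= /reflection coroot_pairing_additive coroot_pairingZ.
by rewrite coroot_pairing_self //; ring.
Qed.

Lemma weyl_comp w1 w2 : weyl w1 -> weyl w2 -> weyl (w1 \o w2).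
Proof.
move=> w1W w2W; elim: w1W => [//|g k {}w1 gD _ IH].
exact: (affine_weyl_comp k gD IH).
Qed.

Lemma weyl_reflection g k : g \in Delta -> weyl (affine_reflection form g k).
Proof. by move=> gD; exact: (affine_weyl_comp k gD (affine_weyl_id _ _)). Qed.

Lemma weyl_inv w : weyl w -> exists w', [/\ weyl w', cancel w w' & cancel w' w].
Proof.
elim=> [|g k {}w gD _ [w' [w'W ww' w'w]]]; first by exists id; split=> //; left.
exists (w' \o affine_reflection form g k); split=> [|x|x] /=.
- exact/weyl_comp/weyl_reflection.
- by rewrite affine_reflectionK.
- by rewrite w'w affine_reflectionK.
Qed.

Lemma weyl_inj w : weyl w -> injective w.
Proof. by move=> /weyl_inv[w' [_ /can_inj]]. Qed.

(** * Simple reflections and longest elements of parabolic subgroups *)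

(** The boolean [i == None], coerced to an integer, is the level: 1 for a_0 = delta - theta and 0
    for the a_i. *)
Definition srefl (i : option node) : V * R -> V * R :=
  affine_reflection form (sroot i).1 (i == None).

Lemma sroot2 i : (sroot i).2 = (Posz (i == None))%:~R.
Proof. by case: i. Qed.

Lemma acoef_srefl i j x :
  acoef j (srefl i x) =
  acoef j x - coroot_pairing form x.1 (sroot i).1 * (i == j)%:R.
Proof.
rewrite -acoef_sroot -acoefZ -acoefN -acoefD; congr acoef.
by rewrite /srefl /affine_reflection -sroot2 mulrC.
Qed.

Lemma weyl_srefl i : weyl (srefl i).
Proof. by apply: weyl_reflection; case: (sroot_affine i).
Qed.

Lemma sreflK i : involutive (srefl i).
Proof. by apply: affine_reflectionK; case: (sroot_affine i). Qed.

Lemma srefl_sroot i : srefl i (sroot i) = - sroot i.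
Proof.
apply: acoef_inj => j; rewrite acoef_srefl coroot_pairing_self; last first.
  by apply: (root_nz rsD); case: (sroot_affine i).
by rewrite acoefN acoef_sroot; ring.
Qed.

(** The reflection changes coordinate i only. By reducedness, a positive affine root other than a_i
    has another positive coordinate, which survives and decides the sign. *)
Lemma srefl_apos i x : apos x -> x != sroot i -> apos (srefl i x).
Proof.
move=> x0 xi; have xa := apos_affine_root x0.
have sa := weyl_affine_root (weyl_srefl i) xa.
have [j ji xj] : exists2 j, j != i & 0 < acoef j x.
  apply: contrapT => no; have xE : x = acoef i x *: (sroot i : V * R^o).
    apply: acoef_inj => j; rewrite acoefZ acoef_sroot.
    have [<-|ij] := eqVneq i j; first by rewrite mulr1.
    rewrite mulr0; apply/eqP; apply: contra_notT no => nz; exists j.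
      by rewrite eq_sym.
    by rewrite lt_def nz apos_acoef.
  have [sD _] := sroot_affine i.
  have xD : acoef i x *: (sroot i).1 \in Delta by case: xa; rewrite {1}xE.
  have [c1|c1] := root_reduced rsD sD xD.
    by rewrite c1 scale1r in xE; rewrite xE eqxx in xi.
  by have := apos_acoef i x0; rewrite c1 lerNr oppr0 ler10.
apply: (affine_root_apos (i := j) sa).
by rewrite acoef_srefl eq_sym (negbTE ji) mulr0 subr0.
Qed.

Let levels : {fset V * R} := (Delta `*` [fset -1; 0; 1])%fset.

(** If g_i + k n_i = 0 with |g_i| <= n_i, then |k| <= 1. Hence the affine roots supported on a
    proper subset of the simple affine roots form a finite set. *)
Lemma affine_root_levels x i : affine_root x -> acoef i x = 0 -> x \in levels.
Proof.
case=> xD xZ xi; rewrite /levels in_fsetM xD /= !inE.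
suff : `|x.2| <= 1.
  have /intrP[k ->] := xZ; rewrite -intr_norm lerz1.
  by case: k => [[|[|k]]|[|k]] //= _;
    rewrite ?NegzE ?rmorphN1 ?mulr0z ?mulr1z eqxx ?orbT.
case: i xi => [i|] /= xi; last by rewrite xi normr0 ler01.
have := root_coef_bound i xD; have th1 := theta_ge1 i.
have th0 : 0 < coef i theta by apply: lt_le_trans th1.
move/eqP: xi; rewrite addr_eq0 => /eqP->; rewrite normrN normrM (gtr0_norm th0).
by rewrite -ler_pdivlMr // divff // gt_eqF.
Qed.

Lemma acoef_srefl_neq i j x : i != j -> acoef j (srefl i x) = acoef j x.
Proof. by move=> /negbTE ij; rewrite acoef_srefl ij mulr0 subr0. Qed.

Lemma apos_oppF x : apos x -> apos (- x) -> False.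
Proof.
move=> /apos_coef_gt0[i xi] /apos_acoef-/(_ i).
by rewrite acoefN oppr_ge0 leNgt xi.
Qed.

(* As long as some [sroot i] with [X i] stays positive, precomposing with its
   reflection adds one root to the finite set of inversions supported on [X]. *)
Lemma longest_element (X : pred (option node)) i0 : ~~ X i0 ->
  exists w, [/\ weyl w, forall x i, ~~ X i -> acoef i (w x) = acoef i x &
                forall i, X i -> apos (- w (sroot i))].
Proof.
move=> Xi0; pose inX x := forall i, ~~ X i -> acoef i x = 0.
pose N (w : V * R -> V * R) : {fset V * R} :=
  [fset x in levels | `[< [/\ inX x, apos x & apos (- w x)] >]]%fset.
have NP w x : reflect [/\ inX x, apos x & apos (- w x)] (x \in N w).
  rewrite in_fset inE /=; apply: (iffP andP) => [[_ /asboolP]//|x0].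
  split; last exact/asboolP; case: x0 => Xx /apos_affine_root xa _.
  exact: (affine_root_levels xa (Xx _ Xi0)).
(* The inversions of [w \o srefl i] contain a_i together with the reflections of those of [w]; a_i
   is not among the latter because its reflection is negative. *)
have N_grow w i : weyl w -> X i -> apos (w (sroot i)) ->
  (#|` N w| < #|` N (w \o srefl i)|)%N.
  move=> wW Xi wi.
  have sN : sroot i \notin (srefl i @` N w)%fset.
    apply/imfsetP => -[/= x /NP[_ x0 _] e]; have := apos_acoef i x0.
    by rewrite -[x](sreflK i) -e srefl_sroot acoefN acoef_sroot eqxx oppr_ge0 ler10.
  have <- : #|` (sroot i |` (srefl i @` N w))%fset| = #|` N w|.+1.
    by rewrite cardfsU1 sN card_imfset //; apply/inv_inj/sreflK.
  apply/fsubset_leq_card/fsubsetP => y; rewrite in_fset1U => /predU1P[->|].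
    apply/NP; split=> [j Xj||] /=; last by rewrite srefl_sroot weylN // opprK.
      by rewrite acoef_sroot; case: eqP Xi Xj => // -> ->.
    exact: sroot_apos.
  move=> /imfsetP[/= x /NP[Xx x0 wx] ->]; apply/NP; split=> /= [j Xj||].
  - by rewrite acoef_srefl_neq ?Xx //; apply: contraNneq Xj => <-.
  - by apply: srefl_apos => //; apply/eqP => e; apply: apos_oppF wi _; rewrite -e.
  - by rewrite sreflK.
(* Here m bounds how many inversions can still be added; at m = 0 one more would overflow
   [levels]. *)
suff step m w : weyl w -> (forall x i, ~~ X i -> acoef i (w x) = acoef i x) ->
    (#|` levels| <= m + #|` N w|)%N ->
    exists w, [/\ weyl w, forall x i, ~~ X i -> acoef i (w x) = acoef i x &
                  forall i, X i -> apos (- w (sroot i))].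
  by apply: (step #|` levels| id) => //; [left | rewrite leq_addr].
elim: m w => [|m IH] w wW wX le.
all: have [all|/existsNP[i /not_implyP[Xi ni]]] :=
  pselect (forall i, X i -> apos (- w (sroot i))); first by exists w.
all: have wi : apos (w (sroot i)) by
  case: (apos_or_opp (weyl_affine_root wW (sroot_affine i))).
all: have grow := N_grow w i wW Xi wi.
  have sub : (#|` N (w \o srefl i)| <= #|` levels|)%N.
    by apply/fsubset_leq_card/fsubsetP => x; rewrite in_fset inE => /andP[].
  by have := leq_trans grow (leq_trans sub le); rewrite add0n ltnn.
apply: (IH (w \o srefl i)).
- exact/weyl_comp/weyl_srefl.
- move=> x j Xj; rewrite /= wX // acoef_srefl_neq //.
  by apply: contraNneq Xj => <-.
- by apply: leq_trans le _; rewrite addSnnS leq_add2l.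
Qed.

Lemma sum_option (F : option node -> R) :
  \sum_i F i = F None + \sum_i F (Some i).
Proof.
rewrite (bigD1 None) //=; congr (_ + _).
by rewrite (reindex_omap Some id) => [|[i|]//]; apply: eq_bigl => i; rewrite eqxx.
Qed.

(** Such an x is a nonnegative combination of simple affine roots that [w] makes negative. *)
Lemma longest_apos_opp (X : pred (option node)) w x : weyl w ->
  (forall i, X i -> apos (- w (sroot i))) ->
  apos x -> (forall i, ~~ X i -> acoef i x = 0) -> apos (- w x).
Proof.
move=> wW neg x0 Xx; have xa := apos_affine_root x0.
apply/(aposP (affine_rootN (weyl_affine_root wW xa))) => j.
rewrite acoefN weyl_acoef // oppr_ge0 sumr_le0 // => i _.
have [Xi|/Xx->] := boolP (X i); last by rewrite mul0r.
by rewrite mulr_ge0_le0 ?apos_acoef // -oppr_ge0 -acoefN apos_acoef //; exact: neg.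
Qed.

(** * Dominance and length of the highest root *)

(** Were the product negative, reflecting theta in a_i would give a root with coefficient above
    n_i. *)
Lemma form_theta_ge0 (i : node) : 0 <= form theta (simple i).
Proof.
have si0 := form_gt0 form (root_nz rsD (simple_root ssP i)).
have := root_coef_bound i (root_reflection rsD (simple_root ssP i) thetaD).
rewrite ler_norml => /andP[_]; rewrite /reflection linearB linearZ /=.
rewrite (coef_simple ssP) eqxx mulr1 gerBl /coroot_pairing.
by rewrite pmulr_lge0 ?invr_gt0 // pmulr_rge0.
Qed.

(** Among the roots as long as b, one of maximal height, b', is dominant. As theta - b' is a
    nonnegative combination of simple roots, its products with theta and with b' are nonnegative;
    they add up to the difference of squared lengths. *)
Lemma theta_long b : b \in Delta -> form b b <= form theta theta.
Proof.
move=> bD; pose ht v := \sum_(i : node) coef i v.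
pose P (c : Delta) := form (val c) (val c) == form b b.
have Pb : P [` bD]%fset by rewrite /P.
have [c /eqP cb cmax] := Order.TotalTheory.arg_maxP (fun c : Delta =>
  ht (val c)) Pb.
rewrite -cb; set b' := val c in cb cmax *; have b'D : b' \in Delta := valP c.
have b'dom (i : node) : 0 <= form b' (simple i).
  rewrite leNgt; apply/negP => neg; have sD := simple_root ssP i.
  have rD := root_reflection rsD sD b'D.
  have s0 := form_gt0 form (root_nz rsD sD).
  have /cmax : P [` rD]%fset.
    by rewrite /P /= form_reflection ?(root_nz rsD) // cb.
  rewrite /= /ht leNgt => /negP[]; rewrite /reflection.
  have -> : \sum_j coef j (b' - coroot_pairing form b' (simple i) *: simple i) =
      \sum_j coef j b' - coroot_pairing form b' (simple i).
    under eq_bigr do rewrite linearB linearZ /= (coef_simple ssP).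
    rewrite sumrB; congr (_ - _); rewrite (bigD1 i) //= eqxx mulr1.
    by rewrite big1 ?addr0 // => j; rewrite eq_sym => /negbTE->; rewrite mulr0.
  by rewrite ltrDl oppr_gt0 /coroot_pairing pmulr_llt0 ?invr_gt0 // pmulr_rlt0.
have sub0 u v : (forall i : node, 0 <= coef i u) -> (forall i :
  node, 0 <= form v (simple i)) ->
    0 <= form v u.
  move=> u0 v0; rewrite (coefK ssP u) linear_sumr sumr_ge0 // => i _.
  by rewrite linearZ_LR mulr_ge0 ?u0 ?v0.
have x0 (i : node) : 0 <= coef i (theta - b').
  rewrite linearB subr_ge0 (le_trans (ler_norm _)) // root_coef_bound //.
have := sub0 _ _ x0 form_theta_ge0; have := sub0 _ _ x0 b'dom.
rewrite !linearBr /= (form_sym form b' theta) => h1 h2.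
by rewrite -subr_ge0; have := addr_ge0 h2 h1; rewrite addrA subrK.
Qed.

(** * Least roots with maximal coefficients on a set of nodes *)

(** This characterises the root gamma_S of the outline. *)
Definition lowest (S : pred node) (gamma : V) : Prop :=
  [/\ pos gamma, forall i, S i -> coef i gamma = coef i theta &
      forall nu, pos nu -> (forall i, S i -> coef i nu = coef i theta) ->
        forall i : node, coef i gamma <= coef i nu].

Lemma lowest_unique S g1 g2 : lowest S g1 -> lowest S g2 -> g1 = g2.
Proof.
move=> [g10 g1S l1] [g20 g2S l2]; apply: (coef_inj ssP) => i.
by apply/eqP; rewrite eq_le l1 // l2.
Qed.

(** Index sets of the parabolic subgroups whose longest elements are w1 (here) and w2
    ([affine_part], which adds a_0). The omitted index that [longest_element] asks for is [None]
    here and an element of S there. *)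
Let finite_part (S : pred node) : pred (option node) :=
  fun i => if i is Some i then ~~ S i else false.

Let affine_part (S : pred node) : pred (option node) :=
  fun i => if i is Some i then ~~ S i else true.

(** For nu with maximal coefficients on S, theta minus the preimage of nu is a nonnegative
    combination of simple roots outside S. Those are sent to negative roots, so the image of theta
    lies below nu. *)
Lemma longest_theta (S : pred node) i0 w : S i0 -> weyl w ->
  (forall x i, ~~ finite_part S i -> acoef i (w x) = acoef i x) ->
  (forall i, finite_part S i -> apos (- w (sroot i))) ->
  exists2 gamma, w (theta, 0) = (gamma, 0) & lowest S gamma.
Proof.
move=> Si0 wW wX neg; exists (w (theta, 0)).1.
  by rewrite [LHS]surjective_pairing; congr (_, _); apply: (wX _ None).
have thetaA : affine_root (theta, 0) by split; rewrite ?rpred0.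
have gA := weyl_affine_root wW thetaA.
have g2 : (w (theta, 0)).2 = 0 by apply: (wX _ None).
have gS i : S i -> coef i (w (theta, 0)).1 = coef i theta.
  by move=> Si; have := wX (theta, 0) (Some i);
    rewrite /= g2 !mul0r !addr0 negbK; apply.
have gpos : pos (w (theta, 0)).1.
  apply: (root_pos rsD ssP (i := i0)); first by case: gA.
  by rewrite gS // (lt_le_trans ltr01) ?theta_ge1.
split=> // nu nu0 nuS.
have [w' [w'W w'K wK]] := weyl_inv wW.
have w'X x i : ~~ finite_part S i -> acoef i (w' x) = acoef i x.
  by move=> Xi; rewrite -wX // wK.
set nu' := w' (nu, 0).
have nu'2 : nu'.2 = 0 by apply: (w'X _ None).
have nu'A : affine_root nu'.
  by apply: weyl_affine_root => //; split; rewrite ?rpred0 ?(posD nu0).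
have x0 i : 0 <= acoef i ((theta, 0) - nu').
  rewrite acoefD acoefN subr_ge0; case: i => [i|]; last by rewrite /= nu'2.
  rewrite /= nu'2 !mul0r !addr0 (le_trans (ler_norm _)) //.
  by apply: root_coef_bound; case: nu'A.
move=> i; rewrite -subr_ge0.
have -> : coef i nu - coef i (w (theta, 0)).1 =
  - acoef (Some i) (w ((theta, 0) - nu')).
  by rewrite weylD // weylN // wK acoefD acoefN /= g2; ring.
rewrite oppr_ge0 weyl_acoef // sumr_le0 // => j _.
have [Xj|Xj] := boolP (finite_part S j).
  by rewrite mulr_ge0_le0 // -oppr_ge0 -acoefN apos_acoef //; exact: neg.
rewrite acoefD acoefN w'X //; case: j Xj => [j|] /= Xj; last by rewrite subrr mul0r.
by rewrite nuS ?subrr ?mul0r //; apply: negbNE.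
Qed.

Lemma lowest_exists (S : pred node) i0 : S i0 -> exists gamma, lowest S gamma.
Proof.
move=> Si0; have [w [wW wX neg]] := longest_element (X := finite_part S) (i0 :=
  None) isT.
by have [g _ gl] := longest_theta Si0 wW wX neg; exists g.
Qed.

(** The root is a Weyl conjugate of theta, and the group preserves lengths. *)
Lemma lowest_long (S : pred node) i0 gamma : S i0 -> lowest S gamma ->
  long_pos_roots form Delta Pi gamma.
Proof.
move=> Si0 lg; split=> [|b bD]; first by case: lg.
have [w [wW wX neg]] := longest_element (X := finite_part S) (i0 := None) isT.
have [g' wg gl] := longest_theta Si0 wW wX neg.
have -> : gamma = (w (theta, 0)).1 by rewrite wg; apply: lowest_unique lg gl.
by rewrite weyl_form //= theta_long.
Qed.

Lemma lowest_coneP (S : pred node) gamma nu : lowest S gamma -> pos nu ->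
  upper_cone Delta Pi gamma nu <-> forall i, S i -> coef i nu = coef i theta.
Proof.
move=> [g0 gS gl] nu0; split=>
  [[_ /(root_leP ssP (posD g0) (posD nu0)) le] i Si|nuS].
  by apply/eqP; rewrite eq_le pos_le_theta //= -(gS _ Si) le.
by split=> //; apply/(root_leP ssP (posD g0) (posD nu0)) => i; apply: gl.
Qed.

(** A sum of two members has coefficient 2 n_i at the node i = [i0] of S, more than any root
    allows. *)
Lemma lowest_cone_abelian (S : pred node) i0 gamma : S i0 -> lowest S gamma ->
  abelian_ideal Delta Pi (upper_cone Delta Pi gamma).
Proof.
move=> Si0 lg; split; first split=> [nu []//|nu g [nu0 le] g0 nug].
  by split=> //; apply: (root_le_trans ssP le nug).
move=> g1 g2 c1 c2 c12; have [g10 _] := c1; have [g20 _] := c2.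
have /(_ _ Si0) e1 := (lowest_coneP lg g10).1 c1.
have /(_ _ Si0) e2 := (lowest_coneP lg g20).1 c2.
have := pos_le_theta i0 c12; rewrite linearD /= e1 e2 gerDl leNgt.
by rewrite (lt_le_trans ltr01) // theta_ge1.
Qed.

(** Enlarging S to all nodes where gamma is maximal ensures g_i < n_i at every node outside it, the
    form in which [lowest_rootlet] and [core_maximal] take S. *)
Lemma lowest_saturate (S : pred node) i0 gamma : S i0 -> lowest S gamma ->
  lowest (fun i => coef i gamma == coef i theta) gamma.
Proof.
move=> Si0 [g0 gS gl]; split=> // [i /eqP//|nu nu0 nuS i].
by apply: gl => // j Sj; apply: nuS; rewrite gS.
Qed.

(** * Constraints on an element whose inversion set encodes a set containing its own rootlet *)

Section Core.
Variables (J : set V) (w : V * R -> V * R) (gamma : V).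
Hypotheses (wW : weyl w) (gamma0 : pos gamma) (Jg : J gamma).
Hypothesis wJ : inversion_set Delta Pi w = [set (- g, 1 : R) | g in J].
Hypothesis wtheta : w (- theta, 2 : R) = (gamma, 0).

(** All inversions of [w] have level 1, whereas a_i has level 0. *)
Lemma core_pos (i : node) : apos (w (sroot (Some i))).
Proof.
have [//|neg] := apos_or_opp (weyl_affine_root wW (sroot_affine (Some i))).
have : inversion_set Delta Pi w (sroot (Some i)) by split=> //; apply: sroot_apos.
by rewrite wJ => -[g _ [_ /eqP]]; rewrite oner_eq0.
Qed.

Lemma core_neg g : J g -> apos (- w (- g, 1)).
Proof. by move=> Jg'; have [] :
  inversion_set Delta Pi w (- g, 1) by rewrite wJ; exists g. Qed.

Lemma core_theta : w (sroot None) = - (- gamma, 1).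
Proof.
have -> : sroot None = (- theta, 2) - (0, 1).
  by congr (_, _); rewrite /= ?subr0 //; ring.
rewrite weylD // weylN // weyl_delta // wtheta.
by congr (_, _); rewrite /= ?opprK ?subr0 // sub0r.
Qed.

Lemma acoef_gamma (i : node) : acoef (Some i) (- gamma, 1) =
  coef i theta - coef i gamma.
Proof. by rewrite /= linearN mul1r addrC. Qed.

Lemma core_aheight :
  aheight (w (- gamma, 1)) = -1 /\
  forall i : node, coef i gamma < coef i theta -> aheight (w (sroot (Some i))) = 1.
Proof.
have hphi : aheight (- gamma, 1) = 1 + \sum_(i :
  node) (coef i theta - coef i gamma).
  by rewrite /aheight sum_option; congr (_ + _); apply: eq_bigr => i _;
    apply: acoef_gamma.
have := weyl_aheight (- gamma, 1) wW;
  rewrite sum_option core_theta aheightN hphi mul1r.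
under [X in _ = _ + X]eq_bigr do rewrite acoef_gamma.
rewrite opprD -addrA [X in _ + X]addrC -sumrB.
under eq_bigr do rewrite -[X in _ - X]mulr1 -mulrBr.
(* T is the sum of (n_i - g_i)(h_i - 1), where h_i is the height of w a_i, and w (delta - gamma) has
   height -1 + T. The terms are nonnegative, while negativity of that root gives T <= 0. *)
set T := \sum_i _ => wphi.
have ge0 (i : node) : 0 <= (coef i theta - coef i gamma) * (aheight (w (sroot
  (Some i))) - 1).
  by rewrite mulr_ge0 // subr_ge0 ?pos_le_theta ?aheight_ge1 //; apply: core_pos.
have T0 : T = 0.
  apply/eqP; rewrite eq_le sumr_ge0 // andbT.
  by have := aheight_ge1 (core_neg Jg);
    rewrite aheightN wphi opprD opprK lerDl oppr_ge0.
split=> [|i lt]; first by rewrite wphi T0 addr0.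
have /eqP := T0; rewrite psumr_eq0 // => /allP/(_ i (mem_index_enum i))/=.
by rewrite mulf_eq0 subr_eq0 gt_eqF //= subr_eq0 => /eqP.
Qed.

(** At coordinate s the expansion of w (delta - gamma) has no a_0 term, since w a_0 = - (delta -
    gamma) vanishes there. The remaining nonnegative terms add up to a coordinate of a negative
    root, so each is 0. *)
Lemma core_support (i s : node) : coef i gamma < coef i theta ->
  coef s gamma = coef s theta -> acoef (Some s) (w (sroot (Some i))) = 0.
Proof.
move=> lt es; have := weyl_acoef (- gamma, 1) (Some s) wW.
rewrite sum_option core_theta acoefN acoef_gamma es subrr oppr0 mulr0 add0r => e.
have ge0 (j : node) : true ->
  0 <= acoef (Some j) (- gamma, 1) * acoef (Some s) (w (sroot (Some j))).
  move=> _; apply: mulr_ge0; last exact/apos_acoef/core_pos.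
  by rewrite acoef_gamma subr_ge0 pos_le_theta.
have /eqP : \sum_(j : node) acoef (Some j) (- gamma, 1) * acoef (Some s) (w
  (sroot (Some j))) = 0.
  apply/eqP; rewrite eq_le sumr_ge0 // andbT -e -oppr_ge0 -acoefN.
  exact/apos_acoef/core_neg.
rewrite psumr_eq0 // => /allP/(_ i (mem_index_enum i))/=.
by rewrite -[X in X * _]/(acoef (Some i) (- gamma, 1)) acoef_gamma mulf_eq0
  subr_eq0 gt_eqF //= => /eqP.
Qed.

(* Otherwise [w] would send [delta - gamma + a_i] to an affine root, or to
   delta, of height [-1 + 1 = 0]. *)
Lemma core_descent (i : node) :
  pos (gamma - simple i) \/ gamma - simple i = 0 -> coef i gamma = coef i theta.
Proof.
move=> desc; apply/eqP; rewrite eq_le pos_le_theta //= leNgt; apply/negP => lt.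
have [h1 /(_ _ lt) h2] := core_aheight.
have e : (- gamma, 1) + sroot (Some i) = (- (gamma - simple i), 1) :> V * R.
  by congr (_, _); rewrite /= ?addr0 // opprB addrC.
have : aheight (w ((- gamma, 1) + sroot (Some i))) = 0.
  by rewrite weylD // aheightD h1 h2 addNr.
rewrite e; case: desc => [g0|->].
  have xA : affine_root (- (gamma - simple i), 1).
    by split; rewrite ?rpred1 //= (root_opp rsD) ?(posD g0).
  have [/aheight_ge1|/aheight_ge1] := apos_or_opp (weyl_affine_root wW xA).
    by move=> + h0; rewrite h0 ler10.
  by rewrite aheightN => + h0; rewrite h0 oppr0 ler10.
(* When gamma = a_i the vector is delta, which [w] fixes and whose height 1 + sum_i n_i is
   positive. *)
rewrite oppr0 weyl_delta // /aheight sum_option => /eqP/=; rewrite gt_eqF //.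
rewrite ltr_pwDl // sumr_ge0 // => j _; rewrite linear0 add0r mul1r.
exact: le_trans ler01 (theta_ge1 j).
Qed.

(* [w] permutes the finitely many affine roots supported on [delta - gamma], so
   it cannot send a further simple root into their span. *)
Lemma core_maximal s0 (S := fun i : node => coef i gamma == coef i theta) :
  S s0 -> lowest S gamma -> J `<=` pos -> J `<=` upper_cone Delta Pi gamma.
Proof.
move=> Ss0 lg Jpos nu Jnu; have nu0 := Jpos _ Jnu.
apply/(lowest_coneP lg nu0) => s Ss; apply/eqP; apply: contraT => neq.
have lt : coef s nu < coef s theta by rewrite lt_neqAle neq pos_le_theta.
pose M x := forall t, S t -> acoef (Some t) x = 0.
have nS (i : node) : ~~ S i -> coef i gamma < coef i theta.
  by move=> Si; rewrite lt_neqAle Si pos_le_theta.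
have MN x : M x -> M (- x) by move=> Mx t St; rewrite acoefN Mx // oppr0.
have Mphi : M (- gamma, 1).
  by move=> t /eqP e; rewrite acoef_gamma e subrr.
have MnS (i : node) : ~~ S i -> M (w (sroot (Some i))).
  by move=> Si t /eqP St; apply: core_support => //; apply: nS.
have MNone : M (w (sroot None)) by rewrite core_theta; apply: MN.
have Mw x : M x -> M (w x).
  move=> Mx t St; rewrite weyl_acoef // sum_option MNone // mulr0 add0r big1 //
    => i _.
  by have [/Mx->|/MnS/(_ _ St)->] := boolP (S i); rewrite ?mul0r ?mulr0.
(* Coordinates of the negative root w (delta - nu) at S are sums of nonnegative terms, hence 0; as
   a_s occurs in delta - nu with coefficient n_s - nu_s > 0, its image vanishes on S too. *)
have Mws : M (w (sroot (Some s))).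
  move=> t St; have neg := apos_acoef (Some t) (core_neg Jnu).
  have x0 : apos (- nu, 1).
    by have [] : inversion_set Delta Pi w (- nu, 1) by rewrite wJ; exists nu.
  have ge0 (j : node) : true ->
    0 <= acoef (Some j) (- nu, 1) * acoef (Some t) (w (sroot (Some j))).
    by move=> _; apply: mulr_ge0; apply: apos_acoef => //; apply: core_pos.
  have /eqP : \sum_(j : node) acoef (Some j) (- nu, 1) * acoef (Some t) (w
    (sroot (Some j))) = 0.
    apply/eqP; rewrite eq_le sumr_ge0 // andbT.
    by rewrite acoefN weyl_acoef // sum_option MNone // mulr0 add0r oppr_ge0 in neg.
  rewrite psumr_eq0 // => /allP/(_ s (mem_index_enum s)).
  rewrite -[X in X * _]/(acoef (Some s) (- nu, 1)) /= linearN mul1r addrC.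
  by rewrite mulf_eq0 subr_eq0 gt_eqF //= => /eqP.
pose F : {fset V * R} := [fset x in levels | `[< affine_root x /\ M x >]]%fset.
have FP x : reflect (affine_root x /\ M x) (x \in F).
  rewrite in_fset inE /=; apply: (iffP andP) => [[_ /asboolP]//|xF].
  split; last exact/asboolP; case: xF => xA /(_ _ Ss0).
  exact: affine_root_levels.
have wF : (w @` F = F)%fset.
  have cw : #|` (w @` F)%fset| = #|` F| by rewrite card_imfset //; apply: weyl_inj.
  apply/eqP; rewrite eqEfcard cw leqnn andbT.
  apply/fsubsetP => _ /imfsetP[/= x /FP[xA Mx] ->]; apply/FP.
  by split; [apply: weyl_affine_root | apply: Mw].
have : w (sroot (Some s)) \in F.
  by apply/FP; split=> //; apply/weyl_affine_root/sroot_affine.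
(* By injectivity a_s itself would vanish on S, yet s is in S. *)
rewrite -wF => /imfsetP[/= x /FP[_ Mx] /(weyl_inj wW) e].
by have := Mx _ Ss; rewrite -e (acoef_sroot (Some s)) eqxx => /eqP;
  rewrite oner_eq0.
Qed.

End Core.

(** * The cone of a least root has that root as its rootlet *)

(** Only positive affine roots vanishing on S can be inverted by w2 w1. At level 0, w1 makes them
    negative and w2 positive again; at positive level w1 keeps them positive and w2 makes them
    negative. *)
Lemma lowest_rootlet i0 gamma (S := fun i : node => coef i gamma == coef i theta) :
  S i0 -> lowest S gamma ->
  is_rootlet form Delta Pi theta (upper_cone Delta Pi gamma) gamma.
Proof.
move=> Si0 lg; have [gamma0 gS gl] := lg.
split; [exact: lowest_cone_abelian Si0 lg | by exists gamma; split=> //;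
  apply: (root_le_refl ssP) |].
have [w1 [w1W w1X neg1]] := longest_element (X := finite_part S) (i0 := None) isT.
have [w2 [w2W w2X neg2]] :=
  longest_element (X := affine_part S) (i0 := Some i0) (introN negP (fun n =>
    n Si0)).
have w1theta : w1 (theta, 0) = (gamma, 0).
  by have [g -> gl'] := longest_theta Si0 w1W w1X neg1;
    rewrite (lowest_unique lg gl').
have w1XA x i : ~~ affine_part S i -> acoef i (w1 x) = acoef i x.
  by case: i => [i|//] Xi; apply: w1X.
pose inA x := forall i, ~~ affine_part S i -> acoef i x = 0.
(* At level k the finite part has coefficients - k n_i on S, so the bound by n_i forces k = 1. *)
have coneP x : apos x -> inA x -> 0 < x.2 ->
    exists2 g, upper_cone Delta Pi gamma g & (- g, 1) = x.
  move=> x0 Ax x2; have [xD xZ] := apos_affine_root x0.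
  have eS i : S i -> coef i (- x.1) = x.2 * coef i theta.
    move=> Si; have /= := Ax (Some i); rewrite /affine_part negbK => /(_ Si) /eqP.
    by rewrite addr_eq0 => /eqP e; rewrite linearN /= e opprK.
  have th0 i : 0 < coef i theta by apply: lt_le_trans ltr01 (theta_ge1 i).
  have x21 : x.2 = 1.
    apply/eqP; rewrite eq_le int_gt0_ge1 // andbT -(ler_pM2r (th0 i0)) mul1r -eS //.
    by rewrite (le_trans (ler_norm _)) // root_coef_bound // (root_opp rsD).
  have g0 : pos (- x.1).
    apply: (root_pos rsD ssP (i := i0)); first exact: (root_opp rsD).
    by rewrite eS // x21 mul1r.
  exists (- x.1); last by rewrite opprK -x21; case: (x).
  by apply/(lowest_coneP lg g0) => i Si; rewrite eS // x21 mul1r.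
have cone_coef g i : upper_cone Delta Pi gamma g -> S i -> coef i g = coef i theta.
  by case=> g0 gg; have := (lowest_coneP lg g0).1 (conj g0 gg); apply.
exists (w2 \o w1); split; first exact: weyl_comp.
- apply/seteqP; split=> [x [x0 /= neg]|_ [g cg <-]].
    have Ax : inA x.
      move=> i Xi; apply/eqP; rewrite eq_le apos_acoef // andbT.
      by have := apos_acoef i neg; rewrite acoefN w2X // w1XA // oppr_ge0.
    apply: coneP => //; rewrite lt_neqAle [X in _ && X](apos_acoef None x0)
      andbT eq_sym.
    apply/eqP => x2; apply: (apos_oppF neg); rewrite opprK.
    have Fx i : ~~ finite_part S i -> acoef i x = 0.
      by case: i => [i|_] //; apply: (Ax (Some i)).
    have n1 := longest_apos_opp w1W neg1 x0 Fx.
    rewrite -[w1 x]opprK weylN //; apply: (longest_apos_opp w2W neg2 n1) => i Xi.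
    by rewrite acoefN w1XA // Ax // oppr0.
  have [g0 _] := cg.
  have xA : affine_root (- g, 1) by split;
    rewrite ?rpred1 //= (root_opp rsD) ?(posD g0).
  have x0 : apos (- g, 1).
    by apply: (affine_root_apos (i := None) xA); rewrite /= ltr01.
  split=> //=; apply: (longest_apos_opp w2W neg2) => [|i Xi].
    apply: (affine_root_apos (i := None)); first exact: weyl_affine_root.
    by rewrite w1X //= ltr01.
  rewrite w1XA //; case: i Xi => [i|//] /=; rewrite negbK => Si.
  by rewrite linearN /= (cone_coef _ _ cg Si) mul1r addNr.
pose phi : V * R := (- gamma, 1).
have phiE : w1 (sroot None) = phi.
  have -> : sroot None = - (theta, 0) + (0, 1).
    by congr (_, _); rewrite /= ?addr0 // oppr0 add0r.
  rewrite weylD // weylN // weyl_delta // w1theta.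
  by congr (_, _); rewrite /= ?addr0 // oppr0 add0r.
have phiA : affine_root phi by split;
  rewrite ?rpred1 //= (root_opp rsD) ?(posD gamma0).
have phi0 : apos phi by apply: (affine_root_apos (i := None) phiA);
  rewrite /= ltr01.
have phi_in : inA phi.
  by case=> [i|//] /=; rewrite negbK => /eqP e; rewrite linearN /= e mul1r addNr.
have phi_gt0 i : affine_part S i -> 0 < acoef i phi.
  case: i => [i|] /= Xi; last exact: ltr01.
  by rewrite linearN mul1r addrC subr_gt0 lt_neqAle Xi pos_le_theta.
(* The goal is x = phi. Once x is written as delta - nu with nu in the cone, x is at most phi in
   each coordinate; but every - w2 a_j with a_j in the support of phi has height at least 1, so x is
   at least as high as phi. *)
set x := - w2 phi.
have x0 : apos x by apply: longest_apos_opp w2W neg2 phi0 phi_in.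
have xin : inA x by move=> i Xi; rewrite /x acoefN w2X // phi_in // oppr0.
have xE i : acoef i x = \sum_j acoef j phi * acoef i (- w2 (sroot j)).
  rewrite /x acoefN weyl_acoef // -sumrN; apply: eq_bigr => j _.
  by rewrite acoefN mulrN.
have term_ge0 i j : 0 <= acoef j phi * acoef i (- w2 (sroot j)).
  have [Xj|/phi_in->] := boolP (affine_part S j); last by rewrite mul0r.
  by rewrite mulr_ge0 ?(ltW (phi_gt0 _ Xj)) // apos_acoef //; apply: neg2.
(* At level 0, every w2 a_j with j in [affine_part S] would have a_0-coordinate 0. So would a_0
   itself, whose preimage under w2 is supported on these a_j. *)
have x2 : 0 < x.2.
  rewrite lt_neqAle [X in _ && X](apos_acoef None x0) andbT eq_sym.
  apply/eqP => e; have /eqP := xE None; rewrite [acoef None x]e eq_sym psumr_eq0 //.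
  move=> /allP vanish; have [w2' [w2'W w2K w2'K]] := weyl_inv w2W.
  have /eqP := weyl_acoef (w2' (sroot None)) None w2W.
  rewrite w2'K big1 ?acoef_sroot ?oner_eq0 // => j _.
  have [Xj|Xj] := boolP (affine_part S j); last first.
    have -> : acoef j (w2' (sroot None)) = 0; last by rewrite mul0r.
    by rewrite -w2X // w2'K acoef_sroot; case: j Xj.
  have : acoef j phi * acoef None (- w2 (sroot j)) == 0 :=
    vanish j (mem_index_enum j).
  by rewrite mulf_eq0 (gt_eqF (phi_gt0 _ Xj)) acoefN oppr_eq0 => /eqP->;
    rewrite mulr0.
have [nu cnu nuE] := coneP x x0 xin x2.
have [nu0 /(root_leP ssP (posD gamma0) (posD nu0)) le_nu] := cnu.
have x_le i : acoef i x <= acoef i phi.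
  rewrite -nuE; case: i => [i|] //=; rewrite !linearN /= !mul1r lerD2r lerN2.
  exact: le_nu.
have hx : aheight phi <= aheight x.
  rewrite /x aheightN weyl_aheight // -sumrN; apply: ler_sum => i _.
  have [Xi|/phi_in->] := boolP (affine_part S i); last by rewrite mul0r oppr0.
  rewrite -mulrN -aheightN ler_peMr ?(ltW (phi_gt0 _ Xi)) //.
  exact/aheight_ge1/neg2.
have xphi : x = phi.
  apply: acoef_inj => i; apply/eqP; rewrite eq_le x_le /=.
  rewrite -subr_le0; apply: le_trans (_ : aheight phi - aheight x <= 0);
    last by rewrite subr_le0.
  rewrite /aheight -sumrB (bigD1 i) //= lerDl sumr_ge0 // => j _.
  by rewrite subr_ge0.
have -> : (- theta, 2) = sroot None + (0, 1).
  by congr (_, _); rewrite /= ?addr0 //; ring.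
rewrite /= weylD // phiE weyl_delta // weylD // weyl_delta //.
rewrite -[w2 phi]opprK -/x xphi.
by congr (_, _); rewrite /= ?addr0 ?opprK ?addNr.
Qed.

(** * Amazing and primitive amazing roots as least roots *)

Local Notation descends i gamma :=
  (pos (gamma - simple i) \/ gamma - simple i = 0).

Lemma lowest_amazing (S : pred node) i0 gamma : S i0 -> lowest S gamma ->
  amazing form Delta Pi theta gamma.
Proof.
move=> Si0 lg; split; first exact: lowest_long Si0 lg.
have [_ gS _] := lg; have Ti0 : coef i0 gamma == coef i0 theta by rewrite gS.
have lT := lowest_saturate Si0 lg.
split; first exact: lowest_rootlet Ti0 lT.
move=> J [[[Jpos _] _] _ [w [wW wJ wth]]] sub; apply/seteqP; split=> //.
have gamma0 : pos gamma by case: lg.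
have Jg : J gamma by apply: sub; split=> //; apply: (root_le_refl ssP).
exact: (core_maximal wW gamma0 Jg wJ wth Ti0 lT Jpos).
Qed.

Lemma descends_exists gamma : pos gamma -> exists i : node, descends i gamma.
Proof.
move=> g0.
have neq : 0 != gamma by rewrite eq_sym (root_nz rsD) // (posD g0).
have le (i : node) : coef i 0 <= coef i gamma by rewrite linear0 (pos_coef ssP).
by have [i [di _]] := root_descent rsD ssP (or_introl (erefl 0)) g0 neq le;
  exists i.
Qed.

(** Subtracting a_i with i outside S would keep the coefficients on S maximal, against leastness;
    and gamma = a_i would have coefficient 0 at [i0]. *)
Lemma lowest_descends (S : pred node) i0 i gamma : S i0 -> lowest S gamma ->
  descends i gamma -> S i.
Proof.
move=> Si0 [g0 gS gl] di; apply: contraT => Si.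
have iS j : S j -> (i == j) = false by move=> Sj; apply: contraNF Si => /eqP->.
case: di => [d0|/eqP].
  have top j : S j -> coef j (gamma - simple i) = coef j theta.
    by move=> Sj; rewrite linearB /= (coef_simple ssP) iS // subr0 gS.
  have := gl _ d0 top i.
  by rewrite linearB /= (coef_simple ssP) eqxx lerBrDl gerDr ler10.
rewrite subr_eq0 => /eqP e; have := theta_ge1 i0.
by rewrite -(gS _ Si0) e (coef_simple ssP) iS // ler10.
Qed.

(** With S the set of subtractable simple roots, [core_descent] gives gamma_S <= gamma. If they
    differed, [root_descent] would give gamma_S <= gamma - a_i for some i in S, which fails at
    coordinate i. *)
Lemma amazing_lowest gamma : amazing form Delta Pi theta gamma ->
  lowest (fun i => `[< descends i gamma >]) gamma.
Proof.
move=> [[g0 _] [[_ _ [w [wW wJ wth]]] _]].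
have Jg : upper_cone Delta Pi gamma gamma by split=> //; apply: (root_le_refl ssP).
have desc (i : node) : descends i gamma -> coef i gamma = coef i theta.
  exact: (core_descent wW g0 Jg wJ wth).
have [i0 di0] := descends_exists g0.
have [g' lg'] := lowest_exists (S := fun i =>
  `[< descends i gamma >]) (asboolT di0).
have [g'0 g'S g'l] := lg'.
have le i : coef i g' <= coef i gamma.
  by apply: g'l => // j /asboolP; apply: desc.
have [e|neq] := eqVneq g' gamma; first by rewrite e in lg'.
have [i [di /(_ i)]] := root_descent rsD ssP (or_intror g'0) g0 neq le.
rewrite linearB /= (coef_simple ssP) eqxx (desc i di) g'S; last exact/asboolP.
by rewrite lerBrDl gerDr ler10.
Qed.

(** As a_i is the only subtractable simple root, every positive root strictly below gamma lies below
    gamma - a_i. Two incomparable roots below gamma thus have the smaller upper bound gamma -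
    a_i. *)
Lemma lowest_primitive (i : node) gamma : lowest (pred1 i) gamma ->
  primitive_amazing form Delta Pi theta gamma.
Proof.
move=> lg; have ii : pred1 i i by rewrite /= eqxx.
split; first exact: lowest_amazing ii lg.
have [g0 _ _] := lg.
move=> [g1 [g2 [[[g10 _] _] [[g20 _] _] n12 n21 [[_ le1 le2] min]]]].
have below g : pos g -> root_le Pi g gamma -> g != gamma ->
    [/\ pos (gamma - simple i) & root_le Pi g (gamma - simple i)].
  move=> gp /(root_leP ssP (posD gp) (posD g0)) le neq.
  have [j [dj lej]] := root_descent rsD ssP (or_intror gp) g0 neq le.
  have /eqP ji := lowest_descends ii lg dj; rewrite ji in dj lej.
  case: dj => [d0|d0]; first by split=> //;
    apply/(root_leP ssP (posD gp) (posD d0)).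
  have [k] := pos_coef_gt0 rsD ssP gp.
  by rewrite ltNge (le_trans (lej k)) // d0 linear0.
have ne1 : g1 != gamma by apply/eqP => e; rewrite -e in le2.
have ne2 : g2 != gamma by apply/eqP => e; rewrite -e in le1.
have [d0 le1'] := below _ g10 le1 ne1; have [_ le2'] := below _ g20 le2 ne2.
have /eqP : gamma - simple i = gamma.
  apply: min; first by split.
  apply/(root_leP ssP (posD d0) (posD g0)) => j.
  by rewrite linearB gerBl /= (coef_simple_ge0 ssP).
rewrite -subr_eq0 addrAC subrr sub0r oppr_eq0.
by rewrite (negbTE (root_nz rsD (simple_root ssP i))).
Qed.

(** If two simple roots a_i and a_j can be subtracted, gamma is the join of the least roots for {i}
    and for the other subtractable nodes. *)
Lemma primitive_lowest gamma : primitive_amazing form Delta Pi theta gamma ->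
  exists i : node, lowest (pred1 i) gamma.
Proof.
move=> [ga np]; have lg := amazing_lowest ga; have [g0 gD gl] := lg.
have [i di] := descends_exists g0; exists i.
have [only|/existsNP[j /not_implyP[dj /eqP ji]]] :=
    pselect (forall j, descends j gamma -> j = i).
  split=> // [k /eqP->|nu nu0 nui]; first exact/gD/asboolP.
  by apply: gl => // k /asboolP/only->; apply: nui; rewrite /= eqxx.
exfalso; apply: np.
have ii : pred1 i i by rewrite /= eqxx.
pose D' : pred node := fun k => `[< descends k gamma >] && (k != i).
have Dj : D' j by rewrite /D' ji andbT; apply/asboolP.
have [g1 l1] := lowest_exists ii; have [g2 l2] := lowest_exists Dj.
have [g10 g1i g1l] := l1; have [g20 g2D g2l] := l2.
have D1 k : pred1 i k -> `[< descends k gamma >] by move=> /eqP->; apply/asboolP.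
have D2 k : D' k -> `[< descends k gamma >] by case/andP.
have gP nu : pos nu -> root_le Pi g1 nu -> root_le Pi g2 nu -> root_le Pi gamma nu.
  move=> nu0 le1 le2; apply/(root_leP ssP (posD g0) (posD nu0)); apply: gl =>
    // k dk.
  have c1 := (lowest_coneP l1 nu0).1 (conj nu0 le1).
  have c2 := (lowest_coneP l2 nu0).1 (conj nu0 le2).
  by have [->|ki] := eqVneq k i; [apply: c1 | apply: c2; rewrite /D' dk].
have le1 : root_le Pi g1 gamma.
  by apply/(root_leP ssP (posD g10) (posD g0)); apply: g1l => // k /D1/gD.
have le2 : root_le Pi g2 gamma.
  by apply/(root_leP ssP (posD g20) (posD g0)); apply: g2l => // k /D2/gD.
exists g1, g2; split.
- exact: lowest_amazing ii l1.
- exact: lowest_amazing Dj l2.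
(* Comparability would make gamma equal to one of the two roots, whose subtractable nodes lie in its
   own half of the splitting. *)
- move=> le12; have e : gamma = g2.
    apply: (root_le_anti ssP (posD g0) (posD g20)) => //.
    by apply: gP => //; apply: (root_le_refl ssP).
  by have := lowest_descends Dj l2; rewrite -e => /(_ i di)/andP[_]; rewrite eqxx.
- move=> le21; have e : gamma = g1.
    apply: (root_le_anti ssP (posD g0) (posD g10)) => //.
    by apply: gP => //; apply: (root_le_refl ssP).
  by have := lowest_descends ii l1; rewrite -e => /(_ j dj) /=; rewrite (negbTE ji).
split=> [|nu [nu0 le1' le2'] nug]; first by split.
by apply: (root_le_anti ssP (posD nu0) (posD g0)) => //; apply: gP.
Qed.

End AffineRoots.

(** * The bijection between primitive amazing roots and simple roots *)

Theorem theorem3p2 (R : realType) (V : vectType R) (form : {dot V for idfun})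
  (Delta Pi : {fset V}) (theta : V)
  (irrDelta : irreducible_root_system form Delta)
  (simplePi : simple_system Delta Pi)
  (highest_theta : highest_root Delta Pi theta) :
  let Apr := primitive_amazing form Delta Pi theta in
  [/\ (Apr #= [set` Pi])%card,
      (forall g, Apr g -> exists! a, a \in Pi /\
         (pos_roots Delta Pi (g - a) \/ g - a = 0)) &
      exists2 f : V -> V,
        (forall g, Apr g -> f g \in Pi /\
           (pos_roots Delta Pi (g - f g) \/ g - f g = 0)) &
        set_bij Apr [set` Pi] f].
Proof.
move=> Apr; have [rsD _ _] := irrDelta.
pose desc g a := a \in Pi /\ (pos_roots Delta Pi (g - a) \/ g - a = 0).
have AprP := primitive_lowest rsD simplePi highest_theta.
have desc_eq (i : 'I_(size (enum_fset Pi))) g a :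
  lowest Delta theta (pred1 i) g -> desc g a ->
    a = (enum_fset Pi)`_(nat_of_ord i).
  move=> lg [/simpleP[j ->] da]; have ii : pred1 i i by rewrite /= eqxx.
  by have /eqP-> := lowest_descends simplePi highest_theta ii lg da.
have desc_uniq g : Apr g -> exists! a, desc g a.
  move=> /AprP[i lg]; have [g0 _ _] := lg.
  have [j dj] := descends_exists rsD simplePi g0.
  have da : desc g (enum_fset Pi)`_(nat_of_ord j) by split; first exact: simple_in.
  exists (enum_fset Pi)`_(nat_of_ord j); split=> // b db.
  by rewrite (desc_eq _ _ _ lg da) (desc_eq _ _ _ lg db).
(* The default 0 is never taken on [Apr], where a subtractable simple root exists. *)
pose f g := xget 0 (desc g).
have fP g : Apr g -> desc g (f g).
  by move=> /desc_uniq[a [da _]]; apply: xgetPex; exists a.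
have fE (i : 'I_(size (enum_fset Pi))) g : lowest Delta theta (pred1 i) g ->
  f g = (enum_fset Pi)`_(nat_of_ord i).
  by move=> lg; apply: (desc_eq _ _ _ lg); apply/fP; apply: lowest_primitive lg.
(* On gamma_{i} the map takes the value a_i; uniqueness of gamma_{i} gives injectivity and its
   existence for every i gives surjectivity. *)
have f_bij : set_bij Apr [set` Pi] f.
  split=> [g /fP[]//|g h|a /simpleP[i ->]].
    rewrite !inE => /AprP[i lg] /AprP[j lh]; rewrite (fE _ _ lg) (fE _ _ lh).
    move=> /(simple_inj simplePi) ij; rewrite ij in lg.
    exact: lowest_unique lg lh.
  have ii : pred1 i i by rewrite /= eqxx.
  have [g lg] := lowest_exists rsD simplePi highest_theta ii.
  by exists g; [apply: lowest_primitive lg | apply: fE].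
split=> //; last by exists f.
by have /bijPex[h] : exists f, set_bij Apr [set` Pi] f;
  [exists f | apply: pcard_eq h].
Qed.
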